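(* Let $V_0=\mathbb{C}[x_1,x_2,\dots]$ be the polynomial algebra in countably many variables, regarded as a Hopf algebra with each $x_i$ primitive, and let $A$ be a commutative $\mathbb{C}$-algebra. Then for any symmetric $A$-valued bicharacters $s_1,s_2$ on $V_0$ there exists an $A$-valued bicharacter $r$ on $V_0$ such that $\mathrm{EQ}_r$ is an algebra isomorphism \[ \mathrm{EQ}_r\colon (V_0\otimes A,\bullet_{s_1})\to (V_0\otimes A,\bullet_{s_2}) \] intertwining the two $\bullet$ products. In particular, for any symmetric $A$-valued bicharacter $s$ there exists an isomorphism $\mathrm{EQ}_r\colon (V_0\otimes A,\cdot)\to (V_0\otimes A,\bullet_s)$ from the standard product to $\bullet_s$.
   Context: The Hopf structure on $V_0$: $\Delta(x_i)=x_i\otimes 1+1\otimes x_i$, $\eta(x_i)=0$, $S(x_i)=-x_i$. Sweedler notation: $\Delta(a)=\sum a'\otimes a''$, $\Delta^2(a)=\sum a'\otimes a''\otimes a'''$. An $A$-valued bicharacter on $V_0$ is a linear map $r:V_0\otimes V_0\to A$ with $r(1\otimes a)=\eta(a)=r(a\otimes 1)$, $r(ab\otimes c)=\sum r(a\otimes c')r(b\otimes c'')$, $r(a\otimes bc)=\sum r(a'\otimes b)r(a''\otimes c)$. $r^t(a\otimes b)=r(b\otimes a)$; $t$ is symmetric if $t=t^t$. For a symmetric bicharacter $t$, $\bullet_t$ is the $A$-bilinear product on $V_0\otimes A$ extending $a\bullet_t b=\sum a'b'\,t(a''\otimes b'')$; the standard product is $\bullet_\epsilon$ with $\epsilon(a\otimes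 b)=\eta(a)\eta(b)$. $\mathrm{EQ}_r(m)=\sum r(m'\otimes m'')m'''$, extended $A$-linearly to $V_0\otimes A$. *)

(* Defs.v *)
From HB Require Import structures.
From mathcomp Require Import all_boot all_order all_algebra.
From mathcomp Require Import finmap.
From mathcomp.multinomials Require Import monalg.
From mathcomp Require Import complex Rstruct.

Set Implicit Arguments.
Unset Strict Implicit.
Unset Printing Implicit Defensive.

Import GRing.Theory.
Local Open Scope ring_scope.

Definition CC := complex Rdefinitions.R.

Notation mon := (cmonom nat).
Notation mon2 := (cmonom (nat + nat)%type).

Notation V0 := {malg CC[mon]}.
(* V_0 (x) V_0 = C[x_i, y_i] via x_i <-> x_i (x) 1, y_i <-> 1 (x) x_i.        *)
Notation V0V0 := {malg CC[mon2]}.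
(* V_0 (x) A = A[x_1, x_2, ...]                                               *)
Notation V0A A := {malg A[mon]}.

Definition mon_map (I J : choiceType) (f : I -> J) (m : cmonom I) : cmonom J :=
  \big[@mulcm J/@onecm J]_(i <- finsupp m) expcmn (ucm (f i)) (m i).

Definition mleft (k : mon2) : mon :=
  \big[@mulcm nat/@onecm nat]_(j <- finsupp k)
     (if j is inl i then expcmn (ucm i) (k j) else @onecm nat).
Definition mright (k : mon2) : mon :=
  \big[@mulcm nat/@onecm nat]_(j <- finsupp k)
     (if j is inr i then expcmn (ucm i) (k j) else @onecm nat).

Definition iota1 (a : V0) : V0V0 :=
  \sum_(m <- msupp a) << a@_m *g mon_map inl m >>.
Definition iota2 (b : V0) : V0V0 :=
  \sum_(m <- msupp b) << b@_m *g mon_map inr m >>.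
Definition tens (a b : V0) : V0V0 := iota1 a * iota2 b.

(* Coproduct: the algebra map with x_i |-> x_i (x) 1 + 1 (x) x_i. *)
Definition Delta (a : V0) : V0V0 :=
  \sum_(m <- msupp a) a@_m *:
     \prod_(i <- finsupp m) (<< ucm (inl i) >> + << ucm (inr i) >>) ^+ (m i).

(* Counit: the algebra map with x_i |-> 0. *)
Definition eta (a : V0) : CC :=
  \sum_(m <- msupp a) a@_m * \prod_(i <- finsupp m) (0 : CC) ^+ (m i).

Section Bichar.
Variable A : comAlgType CC.

(* Sweedler sum  sum F(t', t'')  for t = sum t' (x) t'' in V0 (x) V0 and F
   C-bilinear, evaluated on the monomial basis. *)
Definition sw2 (t : V0V0) (F : V0 -> V0 -> A) : A :=
  \sum_(k <- msupp t) t@_k *: F << mleft k >> << mright k >>.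

Definition rt (r : {linear V0V0 -> A}) (a b : V0) : A := r (tens a b).

Definition bicharacter (r : {linear V0V0 -> A}) : Prop :=
  [/\ forall a, rt r 1 a = (eta a)%:A,
      forall a, rt r a 1 = (eta a)%:A,
      forall a b c, rt r (a * b) c =
                    sw2 (Delta c) (fun c1 c2 => rt r a c1 * rt r b c2)
    & forall a b c, rt r a (b * c) =
                    sw2 (Delta a) (fun a1 a2 => rt r a1 b * rt r a2 c)].

Definition symmetric_bichar (t : {linear V0V0 -> A}) : Prop :=
  forall a b, rt t a b = rt t b a.

Definition bulmon (t : {linear V0V0 -> A}) (m n : mon) : V0A A :=
  let Dm := Delta << m >> in let Dn := Delta << n >> in
  \sum_(k <- msupp Dm) \sum_(l <- msupp Dn)
     ((Dm@_k * Dn@_l)%:A * rt t << mright k >> << mright l >>) *: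
        (<< mleft k >> * << mleft l >> : V0A A).

Definition bul (t : {linear V0V0 -> A}) (p q : V0A A) : V0A A :=
  \sum_(m <- msupp p) \sum_(n <- msupp q) (p@_m * q@_n) *: bulmon t m n.

(* EQ_r(x^m) = sum r(m' (x) m'') m''', with Delta^2 = (Delta (x) id) Delta, so
   that (r (x) id) Delta^2 (m) = sum r(Delta(m')) m''. *)
Definition EQmon (r : {linear V0V0 -> A}) (m : mon) : V0A A :=
  let Dm := Delta << m >> in
  \sum_(k <- msupp Dm) ((Dm@_k)%:A * r (Delta << mleft k >>)) *:
     (<< mright k >> : V0A A).

Definition EQ (r : {linear V0V0 -> A}) (p : V0A A) : V0A A :=
  \sum_(m <- msupp p) p@_m *: EQmon r m.

Definition alg_iso (f : V0A A -> V0A A)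
    (mul1 mul2 : V0A A -> V0A A -> V0A A) : Prop :=
  [/\ forall (a : A) p q, f (a *: p + q) = a *: f p + f q,
      bijective f,
      f 1 = 1
    & forall p q, f (mul1 p q) = mul2 (f p) (f q)].

End Bichar.

(* Main.v *)
(** A bicharacter is determined by its values [f m n] on pairs of monomials, and
    bicharacters form an abelian group under convolution ([conv2]).  Rescaling
    the first argument by [x_i |-> c x_i], i.e. replacing [f m n] by
    [c ^ deg m * f m n], gives the [c]-th convolution power of [f]; it stays
    symmetric because [f m n] vanishes unless [deg m = deg n].  Hence
    [r := s1^(-1/2) s2^(1/2)] is a symmetric bicharacter with [s1 r r = s2].

    Put [phi m := sum r(m', m'')].  Then [EQ_r] is the convolution of [phi] with
    the identity, and the bicharacter laws give
    [phi(ab) = sum phi(a') phi(b') (r r)(a'', b'')], so that [EQ_r] carries the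
    product twisted by [s1] to the product twisted by [s1 r r = s2].  Its inverse
    is [EQ_(r^-1)], and the standard product is the case [s1 = s^0]. *)

Require Import Defs.
From HB Require Import structures.
From mathcomp Require Import all_boot all_order all_algebra.
From mathcomp Require Import finmap.
From mathcomp.multinomials Require Import monalg.
From mathcomp Require Import complex Rstruct ring.
From Stdlib Require Import FunctionalExtensionality.
Set Implicit Arguments.
Unset Strict Implicit.
Unset Printing Implicit Defensive.
Import GRing.Theory.
Local Open Scope ring_scope.

(** * Monomials as words in the variables *)

Local Notation "m ** n" := (@mulcm nat m n) (at level 40, left associativity).
Local Notation "'1m'" := (@onecm nat).

(** Reads one exponent off a product over the support; when [i] lies outside the support, both sides
    are 0. *)
Lemma sum_finsupp (I : choiceType) (m : cmonom I) i (F : I -> nat) :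
  (forall j, F j = (i == j) * m j)%N ->
  (\sum_(j <- finsupp m) F j = m i)%N.
Proof.
move=> FE; under eq_bigr => j _ do rewrite FE.
have [im|im] := boolP (i \in finsupp m).
  rewrite (bigD1_seq i) ?fset_uniq //= eqxx mul1n big1 ?addn0 // => j ji.
  by rewrite eq_sym (negPf ji).
rewrite big1_seq; first by move: im; case: mdomP.
move=> j /= jm; case: eqP => // ij; by rewrite ij jm in im.
Qed.

(** Listing the variables with multiplicity allows recursion on one variable at a time. The order of
    the letters is an artefact of the enumeration, so multiplication by a variable is known only up
    to permutation. *)
Definition word (m : mon) : seq nat :=
  flatten [seq nseq (m i) i | i <- finsupp m].

Lemma count_word m j : count_mem j (word m) = m j.
Proof.
rewrite count_flatten -map_comp sumnE big_map.
by apply: sum_finsupp => i; rewrite /= count_nseq /= eq_sym.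
Qed.

Lemma word_mul i m : perm_eq (word (ucm i ** m)) (i :: word m).
Proof.
by apply/allP => j _ /=; rewrite !count_word mulcmE ucmE; apply/eqP; rewrite eq_sym.
Qed.

Lemma mon_ind (P : mon -> Prop) :
  P 1m -> (forall i m, P m -> P (ucm i ** m)) -> forall m, P m.
Proof.
move=> P1 PX m.
have -> : m = \big[@mulcm nat/1m]_(i <- word m) ucm i.
  apply/eqP/cmP => j; rewrite -[LHS]count_word; elim: (word m) => [|i s IH] /=.
    by rewrite big_nil onecmE.
  by rewrite big_cons mulcmE ucmE IH.
elim: (word m) => [|i s IH]; first by rewrite big_nil.
by rewrite big_cons; apply: PX.
Qed.

(** All [2 ^ size s] ways to distribute the letters over two factors. Equal pairs are kept as often
    as they occur; these repetitions are the binomial coefficients of the coproduct. *)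
Fixpoint splits (s : seq nat) : seq (mon * mon) :=
  if s is i :: s' then
    [seq (ucm i ** p.1, p.2) | p <- splits s'] ++
    [seq (p.1, ucm i ** p.2) | p <- splits s']
  else [:: (1m, 1m)].

Definition ssum (M : zmodType) s (g : mon -> mon -> M) : M :=
  \sum_(p <- splits s) g p.1 p.2.

Lemma ssum_cons (M : zmodType) i s (g : mon -> mon -> M) :
  ssum (i :: s) g =
    ssum s (fun k l => g (ucm i ** k) l) + ssum s (fun k l => g k (ucm i ** l)).
Proof. by rewrite /ssum /= big_cat !big_map. Qed.

Lemma mulcmCA : left_commutative (@mulcm nat).
Proof. by move=> a b c; rewrite !mulcmA [a ** b]mulcmC. Qed.

(** By [mid], a letter can be moved to the front because monomials commute; induction then compares
    the remaining words. *)
Lemma ssum_perm (M : zmodType) s t (g : mon -> mon -> M) :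
  perm_eq s t -> ssum s g = ssum t g.
Proof.
have mid i s1 s2 g' : ssum (s1 ++ i :: s2) g' = ssum (i :: s1 ++ s2) g' :> M.
  elim: s1 g' => [//|j s1 IH] g'.
  rewrite cat_cons ssum_cons !IH !ssum_cons addrACA.
  by congr (_ + _ + (_ + _)); apply: eq_bigr => p _; rewrite mulcmCA.
elim: s t g => [|i s IH] t g; first by rewrite perm_sym => /perm_nilP->.
move=> est; have it : i \in t by rewrite -(perm_mem est) mem_head.
move: est; case/splitPr: it => t1 t2.
rewrite perm_sym -cat1s perm_catCA perm_cons perm_sym => est.
by rewrite mid !ssum_cons !(IH _ _ est).
Qed.

(** * Sweedler calculus for the cocommutative coproduct *)

Section Sweedler.
Variable M : zmodType.
Implicit Types (g : mon -> mon -> M) (m n : mon).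

(* [sw m g] is the Sweedler sum of [g m' m''] over the coproduct of [x^m]. *)
Definition sw m g : M := ssum (word m) g.

Lemma eq_sw g g' m : (forall k l, g k l = g' k l) -> sw m g = sw m g'.
Proof. by move=> gg'; apply: eq_bigr. Qed.

Lemma sw1 g : sw 1m g = g 1m 1m.
Proof. by rewrite /sw /word mdom1 /= /ssum big_seq1. Qed.

(** Primitivity of [x_i]: the new variable goes to the left or to the right factor. With [mon_ind],
    this recursion yields the coalgebra axioms below. *)
Lemma swX i m g :
  sw (ucm i ** m) g =
    sw m (fun k l => g (ucm i ** k) l) + sw m (fun k l => g k (ucm i ** l)).
Proof. by rewrite /sw (ssum_perm _ (word_mul i m)) ssum_cons. Qed.

Lemma swD m g g' : sw m (fun k l => g k l + g' k l) = sw m g + sw m g'.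
Proof. exact: big_split. Qed.

Lemma sw_swap m n (h : mon -> mon -> mon -> mon -> M) :
  sw m (fun a b => sw n (fun c d => h a b c d)) =
  sw n (fun c d => sw m (fun a b => h a b c d)).
Proof. exact: exchange_big. Qed.

Lemma sw_cocomm m g : sw m g = sw m (fun k l => g l k).
Proof.
elim/mon_ind: m g => [|i m IH] g; first by rewrite !sw1.
by rewrite !swX IH addrC [in LHS]IH.
Qed.

Lemma sw_coassoc m (h : mon -> mon -> mon -> M) :
  sw m (fun k l => sw k (fun a b => h a b l)) =
  sw m (fun a l => sw l (fun b c => h a b c)).
Proof.
elim/mon_ind: m h => [|i m IH] h; first by rewrite !sw1.
rewrite !swX.
under eq_sw => k l do rewrite swX.
under [X in _ = _ + X]eq_sw => k l do rewrite swX.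
rewrite !swD (IH (fun a b => h _ b)) (IH (fun a b => h a _)).
by rewrite (IH (fun a b c => h a b (_ ** c))) addrA.
Qed.

(** Coassociativity isolates the two middle factors as the coproduct of a single one, where
    cocommutativity exchanges them. *)
Lemma sw_medial m (h : mon -> mon -> mon -> mon -> M) :
  sw m (fun k l => sw k (fun a b => sw l (fun c d => h a b c d))) =
  sw m (fun k l => sw k (fun a c => sw l (fun b d => h a b c d))).
Proof.
rewrite 2!sw_coassoc.
apply: eq_sw => a l; rewrite -!(sw_coassoc l).
by apply: eq_sw => k d; rewrite [LHS]sw_cocomm.
Qed.

(** The fourfold coproduct in its balanced bracketing. The three lemmas [sw4C12], [sw4C23] and
    [sw4C34] are the adjacent transpositions, so the four factors may be permuted at will. *)
Definition sw4 m (h : mon -> mon -> mon -> mon -> M) : M :=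
  sw m (fun k l => sw k (fun a b => sw l (fun c d => h a b c d))).

Lemma eq_sw4 m h h' : (forall a b c d, h a b c d = h' a b c d) ->
  sw4 m h = sw4 m h'.
Proof. by move=> hh'; rewrite /sw4; do 3 (apply: eq_sw => ? ?). Qed.

Lemma sw4C12 m h : sw4 m h = sw4 m (fun a b c d => h b a c d).
Proof. by rewrite /sw4; apply: eq_sw => k l; rewrite sw_cocomm. Qed.

Lemma sw4C34 m h : sw4 m h = sw4 m (fun a b c d => h a b d c).
Proof. by rewrite /sw4; do 2 (apply: eq_sw => ? ?); rewrite sw_cocomm. Qed.

Lemma sw4C23 m h : sw4 m h = sw4 m (fun a b c d => h a c b d).
Proof. exact: sw_medial. Qed.

Lemma sw4_sw4 m n
    (h : mon -> mon -> mon -> mon -> mon -> mon -> mon -> mon -> M) :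
  sw4 m (fun a b c d => sw4 n (h a b c d)) =
  sw m (fun m1 m2 => sw n (fun n1 n2 =>
    sw m1 (fun a b => sw m2 (fun c d =>
      sw n1 (fun a' b' => sw n2 (h a b c d a' b')))))).
Proof.
rewrite /sw4; apply: eq_sw => m1 m2; rewrite [RHS]sw_swap; apply: eq_sw => a b.
by rewrite [RHS]sw_swap.
Qed.

(** The coproduct is an algebra map. *)
Lemma sw_mul m n g :
  sw (m ** n) g = sw m (fun a b => sw n (fun c d => g (a ** c) (b ** d))).
Proof.
elim/mon_ind: m g => [|i m IH] g.
  by rewrite sw1 mul0cm; apply: eq_sw => k l; rewrite !mul0cm.
rewrite -mulcmA !swX !IH; congr (_ + _);
  by do 2 (apply: eq_sw => ? ?); rewrite mulcmA.
Qed.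

(** The counit axiom: a splitting that puts a variable into [k] contributes nothing, since then [k]
    is not 1. *)
Lemma sw_counit m (g : mon -> M) : sw m (fun k l => g l *+ (k == 1m)) = g m.
Proof.
elim/mon_ind: m g => [|i m IH] g; first by rewrite sw1 eqxx.
rewrite swX IH; under eq_sw => k l.
  rewrite (_ : (_ == _) = false); first over.
  by apply/negP => /unitmP[]; rewrite cm1_eq1.
by rewrite /sw /ssum big1 ?add0r.
Qed.

End Sweedler.

Lemma raddf_sw (M N : zmodType) (h : {additive M -> N}) m g :
  h (sw m g) = sw m (fun k l => h (g k l)).
Proof. exact: raddf_sum. Qed.

(** * Convolution algebras and bicharacters on monomials *)

Section Convolution.
Variable B : comNzRingType.
Implicit Types (f g h : mon -> mon -> B) (p q : mon -> B) (m n : mon) (c d : B).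

Lemma mulr_sw c m (g : mon -> mon -> B) :
  c * sw m g = sw m (fun k l => c * g k l).
Proof. exact: mulr_sumr. Qed.

Lemma sw_mulr c m (g : mon -> mon -> B) :
  sw m g * c = sw m (fun k l => g k l * c).
Proof. exact: mulr_suml. Qed.

Definition conv1 p q m : B := sw m (fun k l => p k * q l).

Definition conv2 f g m n : B :=
  sw m (fun a b => sw n (fun k l => f a k * g b l)).

Definition counit m : B := (m == 1m)%:R.

Definition tens2 p q m n : B := p m * q n.

Lemma conv1A p q q' : conv1 p (conv1 q q') = conv1 (conv1 p q) q'.
Proof.
apply: functional_extensionality => m; rewrite /conv1.
under [RHS]eq_sw => k l do rewrite sw_mulr.
rewrite sw_coassoc; apply: eq_sw => a l; rewrite mulr_sw.
by apply: eq_sw => b c; rewrite mulrA.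
Qed.

Lemma conv1_counit p : conv1 counit p = p.
Proof.
apply: functional_extensionality => m; rewrite /conv1.
under eq_sw => k l do rewrite mulr_natl.
exact: sw_counit.
Qed.

Lemma conv2A f g h : conv2 f (conv2 g h) = conv2 (conv2 f g) h.
Proof.
do 2 apply: functional_extensionality => ?; rewrite /conv2.
under eq_sw => a b do under eq_sw => c d do rewrite mulr_sw.
under eq_sw => a b do rewrite sw_swap.
under [RHS]eq_sw => a b do under eq_sw => c d do rewrite sw_mulr.
under [RHS]eq_sw => a b do rewrite sw_swap.
rewrite [RHS]sw_coassoc; apply: eq_sw => a b; apply: eq_sw => a' b'.
under eq_sw => c d do rewrite mulr_sw.
under [RHS]eq_sw => c d do rewrite sw_mulr.
rewrite [RHS]sw_coassoc; apply: eq_sw => c d; apply: eq_sw => c' d'.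
exact: mulrA.
Qed.

Lemma conv2C f g : conv2 f g = conv2 g f.
Proof.
do 2 apply: functional_extensionality => ?; rewrite /conv2.
rewrite sw_cocomm; apply: eq_sw => a b; rewrite sw_cocomm.
by apply: eq_sw => c d; rewrite mulrC.
Qed.

Lemma conv2_counit f : conv2 (tens2 counit counit) f = f.
Proof.
do 2 apply: functional_extensionality => ?; rewrite /conv2 /tens2.
under eq_sw => a b do under eq_sw => c d do
  rewrite -mulrA !mulr_natl mulrnAC.
under eq_sw => a b do rewrite (sw_counit _ (fun k => f b k *+ _)).
exact: (sw_counit _ (fun a => f a _)).
Qed.

(** Pullback along multiplication. Since multiplication is a coalgebra map, it turns [conv1] into
    [conv2], see [mu_conv]. *)
Definition mu p m n : B := p (m ** n).

Lemma mu_conv p q : mu (conv1 p q) = conv2 (mu p) (mu q).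
Proof.
by do 2 apply: functional_extensionality => ?; rewrite /mu /conv1 sw_mul.
Qed.

Definition bichar f : Prop :=
  [/\ forall m, f 1m m = counit m,
      forall m, f m 1m = counit m,
      forall a b k, f (a ** b) k = sw k (fun k1 k2 => f a k1 * f b k2)
    & forall a b k, f a (b ** k) = sw a (fun a1 a2 => f a1 b * f a2 k)].

Definition symm f : Prop := forall m n, f m n = f n m.

(* For a bicharacter [f] this is the [c]-th convolution power, see [scl_conv]. *)
Definition scl c f m n : B := c ^+ mdeg m * f m n.

Definition diag f m : B := sw m f.

Lemma expr_mdegX c i m : c ^+ mdeg (ucm i ** m) = c * c ^+ mdeg m.
Proof. by rewrite mdegM mdegU exprS. Qed.

Lemma expr_mdeg_sw c m (g : mon -> mon -> B) :
  c ^+ mdeg m * sw m g =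
  sw m (fun k l => c ^+ mdeg k * c ^+ mdeg l * g k l).
Proof.
elim/mon_ind: m g => [|i m IH] g; first by rewrite !sw1 mdeg1 expr0 !mul1r.
rewrite expr_mdegX !swX -mulrA mulrDr !IH mulrDr !mulr_sw.
congr (_ + _); apply: eq_sw => k l; rewrite expr_mdegX.
  by rewrite !mulrA.
by rewrite [X in _ = X * _]mulrCA !mulrA.
Qed.

(** The binomial theorem: [k ** l] is [m] in every splitting, so the factor [p] is constant. *)
Lemma sw_exprD c d m p :
  sw m (fun k l => c ^+ mdeg k * d ^+ mdeg l * p (k ** l)) =
  (c + d) ^+ mdeg m * p m.
Proof.
elim/mon_ind: m p => [|i m IH] p; first by rewrite !sw1 mdeg1 expr0 !mul1r mul0cm.
rewrite expr_mdegX -mulrA mulrDl -(IH (fun x => p (ucm i ** x))) swX !mulr_sw.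
congr (_ + _); apply: eq_sw => k l; rewrite expr_mdegX.
  by rewrite mulcmA !mulrA.
by rewrite mulcmCA [X in X * _ = _]mulrCA !mulrA.
Qed.

Lemma scl1 f : scl 1 f = f.
Proof.
by do 2 apply: functional_extensionality => ?; rewrite /scl expr1n mul1r.
Qed.

(** Since [0 ^+ 0 = 1], exactly the terms with first argument 1 survive. *)
Lemma scl0 f : bichar f -> scl 0 f = tens2 counit counit.
Proof.
case=> f1 _ _ _; do 2 apply: functional_extensionality => ?.
rewrite /scl /tens2 /counit expr0n mdeg_eq0; case: eqP => [->|_].
  by rewrite f1.
by rewrite !mul0r.
Qed.

(** The left law gathers the two values of [f] into one value at [a ** b], and the powers add up by
    the binomial theorem. *)
Lemma scl_conv c d f : bichar f -> conv2 (scl c f) (scl d f) = scl (c + d) f.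
Proof.
case=> _ _ fM _; do 2 apply: functional_extensionality => ?.
rewrite /conv2 /scl -[RHS](sw_exprD _ _ _ (fun m => f m _)).
apply: eq_sw => a b; rewrite fM mulr_sw; apply: eq_sw => k l.
exact: mulrACA.
Qed.

(** This form of homogeneity says that rescaling either argument has the same effect, which is what
    [symm_scl] needs. For a single variable on the left ([homX]), primitivity kills all values
    except those on degree one; the left law then extends this to all [m]. *)
Lemma bichar_hom c f m n : bichar f -> c ^+ mdeg m * f m n = c ^+ mdeg n * f m n.
Proof.
case=> f1 f1' fl fr; have homX i k : c * f (ucm i) k = c ^+ mdeg k * f (ucm i) k.
  elim/mon_ind: k => [|j k IH].
    by rewrite f1' /counit cm1_eq1 !mulr0.
  rewrite expr_mdegX fr.
  have -> : ucm i = ucm i ** 1m by rewrite mulcm0.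
  rewrite swX !sw1 !mulcm0 !f1 /counit cm1_eq1 mul0r addr0.
  by case: eqP => [->|_]; rewrite ?mdeg1 ?mulr0 ?mulr1 ?expr1.
elim/mon_ind: m n => [|i m IH] n.
  rewrite f1 /counit; case: eqP => [->|_] //; by rewrite !mulr0.
rewrite expr_mdegX fl expr_mdeg_sw mulr_sw; apply: eq_sw => k l.
by rewrite mulrACA homX IH mulrACA.
Qed.

Lemma bichar_scl c f : bichar f -> bichar (scl c f).
Proof.
move=> bf; have [f1 f1' fl fr] := bf; split => [m|m|a b k|a b k]; rewrite /scl.
- by rewrite f1 mdeg1 mul1r.
- by rewrite f1' /counit; case: eqP => [->|_]; rewrite ?mdeg1 ?mul1r ?mulr0.
- rewrite fl mdegM exprD mulr_sw; apply: eq_sw => ? ?; exact: mulrACA.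
- rewrite fr expr_mdeg_sw; apply: eq_sw => ? ?; exact: mulrACA.
Qed.

Lemma symm_scl c f : bichar f -> symm f -> symm (scl c f).
Proof. by move=> bf sf m n; rewrite /scl bichar_hom // sf. Qed.

Lemma symm_conv2 f g : symm f -> symm g -> symm (conv2 f g).
Proof.
move=> sf sg m n; rewrite /conv2 sw_swap.
by do 2 (apply: eq_sw => ? ?); rewrite sf sg.
Qed.

Lemma conv2E f g m n : conv2 f g m n = sw m (fun a b => conv1 (f a) (g b) n).
Proof. by []. Qed.

Lemma conv1_sw a b (f g : mon -> mon -> mon -> B) n :
  conv1 (fun k => sw a (fun x y => f x y k)) (fun k => sw b (fun x y => g x y k)) n
  = sw a (fun a1 a2 => sw b (fun b1 b2 => conv1 (f a1 a2) (g b1 b2) n)).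
Proof.
rewrite /conv1.
under eq_sw => k l do rewrite sw_mulr.
rewrite sw_swap; apply: eq_sw => a1 a2.
under eq_sw => k l do rewrite mulr_sw.
by rewrite sw_swap.
Qed.

Lemma conv1C p q : conv1 p q = conv1 q p.
Proof.
apply: functional_extensionality => m; rewrite /conv1 sw_cocomm.
by apply: eq_sw => k l; rewrite mulrC.
Qed.

Lemma conv1ACA : interchange conv1 conv1.
Proof.
move=> p q p' q'.
by rewrite -!conv1A; congr conv1; rewrite !conv1A [conv1 q _]conv1C.
Qed.

(** The third law of [bichar], isolated because the fourth is this law for the transpose. *)
Definition lmul f : Prop :=
  forall a b k, f (a ** b) k = sw k (fun k1 k2 => f a k1 * f b k2).

(** For a fixed first argument, the law reads [f (a ** b) = conv1 (f a) (f b)]; the interchange law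
    of the commutative product [conv1] then does the rest. *)
Lemma lmul_conv2 f g : lmul f -> lmul g -> lmul (conv2 f g).
Proof.
move=> fl gl a b n.
rewrite -[RHS]/(conv1 (conv2 f g a) (conv2 f g b) n) [LHS]conv2E sw_mul.
rewrite [RHS](conv1_sw a b (fun x y => conv1 (f x) (g y))
                           (fun x y => conv1 (f x) (g y))).
do 2 (apply: eq_sw => ? ?); rewrite conv1ACA.
by congr conv1; apply: functional_extensionality => ?; rewrite (fl, gl).
Qed.

Lemma bichar_conv2 f g : bichar f -> bichar g -> bichar (conv2 f g).
Proof.
move=> [f1 f1' fl fr] [g1 g1' gl gr]; split => [m|m||a b k]; rewrite /conv2.
- rewrite sw1; under eq_sw => c d do rewrite f1 g1 mulr_natl.
  exact: sw_counit.
- under eq_sw => c d do rewrite sw1 f1' g1' mulr_natl.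
  exact: sw_counit.
- exact: lmul_conv2.
(* The right law is the left law of the transposed functions. *)
have := @lmul_conv2 (fun x y => f y x) (fun x y => g y x)
  (fun x y z => fr z x y) (fun x y z => gr z x y) b k a.
rewrite /conv2 sw_swap => ->.
by apply: eq_sw => ? ?; congr (_ * _); rewrite sw_swap.
Qed.

(** This is the formula for [phi(ab)]. Both laws expand [f] on a pair of products into four values,
    which are regrouped by cocommutativity. *)
Lemma mu_diag f : bichar f -> symm f ->
  mu (diag f) = conv2 (tens2 (diag f) (diag f)) (conv2 f f).
Proof.
move=> [_ _ fl fr] sf.
apply: functional_extensionality => a; apply: functional_extensionality => b.
(* The fully expanded left side: [a] and [b] are each cut into four, one value of [f] for each pair
   of halves. *)
transitivity (sw4 a (fun a1 a2 a3 a4 => sw4 b (fun b1 b2 b3 b4 =>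
  (f a1 a3 * f a2 b3) * (f b1 a4 * f b2 b4)))).
  rewrite sw4_sw4 /mu /diag sw_mul.
  do 2 (apply: eq_sw => ? ?); rewrite fl sw_mul.
  under eq_sw => ? ? do under eq_sw => ? ? do rewrite !fr sw_mulr.
  under eq_sw => ? ? do rewrite sw_swap.
  rewrite sw_swap.
  do 2 (apply: eq_sw => ? ?); rewrite [RHS]sw_swap.
  by apply: eq_sw => ? ?; rewrite mulr_sw.
transitivity (sw4 a (fun a1 a2 a3 a4 => sw4 b (fun b1 b2 b3 b4 =>
  (f a1 a2 * f b1 b2) * (f a3 b3 * f a4 b4)))); last first.
  rewrite sw4_sw4 /conv2 /tens2 /diag.
  do 2 (apply: eq_sw => ? ?).
  rewrite !sw_mulr; apply: eq_sw => ? ?.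
  rewrite [LHS]sw_swap mulr_sw sw_mulr; apply: eq_sw => ? ?.
  rewrite mulr_sw; apply: eq_sw => ? ?.
  by rewrite mulr_sw.
rewrite sw4C23; apply: eq_sw4 => a1 a2 a3 a4.
(* These swaps rename [b1, b2, b4] to [b4, b1, b2] and fix [b3]. The value [f b4 a4] that results is
   then reversed by symmetry. *)
rewrite sw4C12 sw4C23 sw4C34 sw4C23; apply: eq_sw4 => b1 b2 b3 b4.
rewrite (sf b4); ring.
Qed.

(** With [p] the inclusion of monomials, the left side is [EQ] applied to the product twisted by
    [g], and the right side is the product twisted by [g f f] of two images. *)
Lemma mu_conv_diag f g p : bichar f -> symm f ->
  conv2 (mu (conv1 (diag f) p)) g =
  conv2 (tens2 (diag f) (diag f)) (conv2 (mu p) (conv2 g (conv2 f f))).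
Proof.
move=> bf sf; rewrite mu_conv mu_diag // -2!conv2A; congr (conv2 _ _).
by rewrite conv2C -conv2A.
Qed.

(** Exchanging the two middle factors of the fourfold coproduct shows that [diag] respects
    convolution; hence convolution inverses give inverse maps [EQ]. *)
Lemma conv1_diag f g : conv1 (diag f) (diag g) = diag (conv2 f g).
Proof.
apply: functional_extensionality => m; rewrite /conv1 /diag /conv2.
rewrite -[RHS](sw4C23 m (fun x y z t => f x y * g z t)).
by apply: eq_sw => k l; rewrite sw_mulr; apply: eq_sw => a b; rewrite mulr_sw.
Qed.

Lemma diag_counit : diag (tens2 counit counit) = counit.
Proof.
apply: functional_extensionality => m; rewrite /diag /tens2.
under eq_sw => k l do rewrite mulr_natl.
exact: sw_counit.
Qed.

Lemma conv2ACA : interchange conv2 conv2.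
Proof.
move=> f g f' g'.
by rewrite -!conv2A; congr conv2; rewrite !conv2A [conv2 g _]conv2C.
Qed.

(** Scaling by -1 composes [f] with the antipode in the first argument. *)
Lemma scl_inv f : bichar f -> conv2 (scl (-1) f) f = tens2 counit counit.
Proof. by move=> bf; rewrite -[f in X in conv2 _ X]scl1 scl_conv // addNr scl0. Qed.

(** The element [c] plays the part of one half, so the two halves of [f] in [conv2 h h] combine to
    the inverse of [f], and those of [g] to [g]. *)
Lemma bichar_sqrt c f g : c + c = 1 ->
  bichar f -> symm f -> bichar g -> symm g ->
  exists h, [/\ bichar h, symm h & conv2 f (conv2 h h) = g].
Proof.
move=> c2 bf sf bg sg; exists (conv2 (scl (- c) f) (scl c g)).
split.
- by apply: bichar_conv2; exact: bichar_scl.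
- by apply: symm_conv2; exact: symm_scl.
rewrite conv2ACA !scl_conv // -opprD c2 scl1 conv2A [conv2 f _]conv2C scl_inv //.
exact: conv2_counit.
Qed.

End Convolution.

(** * Linear extension from a basis of monomials *)

Section LinearExtension.
Variables (K : choiceType) (R : nzRingType) (M : lmodType R) (h : K -> M).

(** Shaped like the sums over supports that define [Delta], [sw2], [EQ] and [bul], so that these are
    linear extensions almost by unfolding. *)
Definition linext (t : {malg R[K]}) : M := \sum_(k <- msupp t) t@_k *: h k.

Lemma linext_le (d : {fset K}) t : (msupp t `<=` d)%fset ->
  linext t = \sum_(k <- d) t@_k *: h k.
Proof.
move=> td; rewrite /linext (big_fset_incl _ td) //= => k _ /mcoeff_outdom ->.
by rewrite scale0r.
Qed.

Lemma linext_is_linear : linear linext.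
Proof.
(* One finite set containing all three supports makes the sums comparable term by term. *)
move=> c p q; pose d := (msupp p `|` msupp q `|` msupp (c *: p + q))%fset.
have pd : (msupp p `<=` d)%fset by rewrite /d -fsetUA fsubsetUl.
have qd : (msupp q `<=` d)%fset by rewrite /d fsetUAC fsubsetUr.
have pqd : (msupp (c *: p + q) `<=` d)%fset by rewrite /d fsubsetUr.
rewrite (linext_le pd) (linext_le qd) (linext_le pqd).
rewrite scaler_sumr -big_split; apply: eq_bigr => k _ /=.
by rewrite mcoeffD mcoeffZ scalerDl scalerA.
Qed.

HB.instance Definition _ :=
  GRing.isLinear.Build R {malg R[K]} M *:%R linext linext_is_linear.

Lemma linextU c k : linext << c *g k >> = c *: h k.
Proof.
rewrite (@linext_le [fset k]%fset) ?msuppU_le // big_seq_fset1.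
by rewrite mcoeffUU.
Qed.

Lemma linextU1 k : linext << k >> = h k.
Proof. by rewrite linextU scale1r. Qed.

Lemma linextD p q : linext (p + q) = linext p + linext q.
Proof. exact: linearD. Qed.

Lemma linextP c p q : linext (c *: p + q) = c *: linext p + linext q.
Proof. exact: linearP. Qed.

End LinearExtension.

Lemma malg_ind (K : choiceType) (R : nzRingType) (P : {malg R[K]} -> Prop) :
  P 0 -> (forall c k p, P p -> P (c *: << k >> + p)) -> forall p, P p.
Proof.
move=> P0 PD p; rewrite [p]monalgE; elim: (enum_fset _) => [|k s IH].
  by rewrite big_nil.
rewrite big_cons (_ : << _ *g _ >> = p@_k *: << k >>); first exact: PD.
by apply/malgP => j; rewrite mcoeffZ !mcoeffU mulr_natr.
Qed.

Lemma malgU_Z (K : choiceType) (R : nzRingType) (c : R) (k : K) :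
  << c *g k >> = c *: << k >>.
Proof.
by apply/malgP => j; rewrite mcoeffZ !mcoeffU mulr_natr.
Qed.

Lemma malgUM (K : monomType) (R : nzRingType) (k l : K) :
  (<< k >> * << l >> : {malg R[K]}) = << mul k l >>.
Proof. by rewrite malgM_def fgmulUU mulr1. Qed.

Lemma linear_map0 (R : nzRingType) (V W : lmodType R) (h : V -> W) :
  (forall c x y, h (c *: x + y) = c *: h x + h y) -> h 0 = 0.
Proof. by move/(_ (-1) 0 0); rewrite scaler0 addr0 scaleN1r addNr. Qed.

Lemma linext_mulU (K : conomType) (R : comNzRingType) (M : lmodType R)
    (h : K -> M) k (p : {malg R[K]}) :
  linext h (<< k >> * p) = linext (fun l => h (mul k l)) p.
Proof.
elim/malg_ind: p => [|c l p IH]; first by rewrite mulr0 !linear0.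
by rewrite mulrDr -scalerAr malgUM !linearP /= !linextU1 IH.
Qed.

(* The monomial [x^k (x) x^l] of [V0V0]. *)
Definition emb (k l : mon) : mon2 := mulcm (mon_map inl k) (mon_map inr l).

(** * Monomials in two families of variables, and the coproduct *)

Lemma bigmulcmE (I J : choiceType) (s : seq I) (F : I -> cmonom J) j :
  (\big[@mulcm J/@onecm J]_(i <- s) F i) j = (\sum_(i <- s) F i j)%N.
Proof.
elim: s => [|i s IH]; first by rewrite !big_nil onecmE.
by rewrite !big_cons mulcmE IH.
Qed.

Lemma expcmnE (I : choiceType) (m : cmonom I) n i : expcmn m n i = (n * m i)%N.
Proof.
rewrite /expcmn; case: n => [|n]; first by rewrite onecmE.
rewrite iteropS; elim: n => [|n IH]; first by rewrite mul1n.
by rewrite iterS mulcmE IH.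
Qed.

Lemma mon_mapE (I J : choiceType) (f : I -> J) (m : cmonom I) i :
  injective f -> mon_map f m (f i) = m i.
Proof.
move=> fI; rewrite bigmulcmE; apply: sum_finsupp => j.
by rewrite expcmnE ucmE (inj_eq fI) mulnC eq_sym.
Qed.

Lemma mon_map_out (I J : choiceType) (f : I -> J) (m : cmonom I) j :
  (forall i, f i != j) -> mon_map f m j = 0%N.
Proof.
move=> fj; rewrite bigmulcmE big1 // => i _.
by rewrite expcmnE ucmE (negPf (fj i)) muln0.
Qed.

Lemma embl k l i : emb k l (inl i) = k i.
Proof. by rewrite mulcmE mon_mapE ?mon_map_out ?addn0 // => ? ? []. Qed.

Lemma embr k l i : emb k l (inr i) = l i.
Proof. by rewrite mulcmE mon_mapE ?mon_map_out ?add0n // => ? ? []. Qed.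

Lemma mleftE k i : mleft k i = k (inl i).
Proof.
rewrite bigmulcmE; apply: sum_finsupp => -[j|j]; last by rewrite onecmE.
by rewrite expcmnE ucmE mulnC eq_sym.
Qed.

Lemma mrightE k i : mright k i = k (inr i).
Proof.
rewrite bigmulcmE; apply: sum_finsupp => -[j|j]; first by rewrite onecmE.
by rewrite expcmnE ucmE mulnC eq_sym.
Qed.

Lemma mleft_emb k l : mleft (emb k l) = k.
Proof. by apply/eqP/cmP => i; rewrite mleftE embl. Qed.

Lemma mright_emb k l : mright (emb k l) = l.
Proof. by apply/eqP/cmP => i; rewrite mrightE embr. Qed.

Lemma emb_split k : emb (mleft k) (mright k) = k.
Proof.
by apply/eqP/cmP => -[i|i]; rewrite (embl, embr) (mleftE, mrightE).
Qed.

Lemma emb_mulXl i k l : emb (ucm i ** k) l = mulcm (ucm (inl i)) (emb k l).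
Proof.
apply/eqP/cmP => -[j|j]; rewrite [RHS]mulcmE ucmE ?(embl, embr) //.
by rewrite mulcmE ucmE.
Qed.

Lemma emb_mulXr i k l : emb k (ucm i ** l) = mulcm (ucm (inr i)) (emb k l).
Proof.
apply/eqP/cmP => -[j|j]; rewrite [RHS]mulcmE ucmE ?(embl, embr) //.
by rewrite mulcmE ucmE.
Qed.

Lemma prod_word (R : pzSemiRingType) (h : nat -> R) (m : mon) :
  \prod_(i <- finsupp m) h i ^+ m i = \prod_(i <- word m) h i.
Proof.
rewrite big_flatten big_map /=; apply: eq_bigr => i _.
by rewrite big_nseq -Monoid.iteropE.
Qed.

Definition DeltaU (R : comNzRingType) (m : mon) : {malg R[mon2]} :=
  \prod_(i <- word m) (<< ucm (inl i) >> + << ucm (inr i) >>).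

(** The bridge from the coproduct polynomial to splittings. Both obey the same recursion along the
    word, so neither the support nor the coefficients of the coproduct have to be computed. *)
Lemma linext_DeltaU (R : comNzRingType) (M : lmodType R) (g : mon2 -> M) m :
  linext g (DeltaU R m) = sw m (fun k l => g (emb k l)).
Proof.
rewrite /DeltaU /sw; elim: (word m) g => [|i s IH] g.
  rewrite big_nil /ssum big_seq1 linextU1; congr g.
  by apply/eqP/cmP => -[j|j]; rewrite (embl, embr) !onecmE.
rewrite big_cons mulrDl linextD ssum_cons; congr (_ + _).
  rewrite (linext_mulU g (ucm (inl i))) IH.
  by apply: eq_bigr => p _; rewrite emb_mulXl.
rewrite (linext_mulU g (ucm (inr i))) IH.
by apply: eq_bigr => p _; rewrite emb_mulXr.
Qed.

Lemma Delta_linext : Delta = linext (DeltaU CC).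
Proof.
apply: functional_extensionality => a.
by apply: eq_bigr => m _; rewrite prod_word.
Qed.

Lemma prod_expr0 (m : mon) : \prod_(i <- finsupp m) (0 : CC) ^+ m i = (m == 1m)%:R.
Proof.
rewrite [LHS](prod_word (fun=> 0 : CC) m); case: eqP => [->|m1].
  by rewrite /word mdom1 big_nil.
case Ew: (word m) => [|i s]; last by rewrite big_cons mul0r.
by case: m1; apply/eqP/cmP => j; rewrite -count_word Ew onecmE.
Qed.

Lemma eta_linext : Defs.eta = linext (fun m => (m == 1m)%:R : CC^o).
Proof.
apply: functional_extensionality => a.
by apply: eq_bigr => m _; rewrite prod_expr0.
Qed.

Lemma iota1_linext : iota1 = linext (fun m => << mon_map inl m >>).
Proof.
by apply: functional_extensionality => a; apply: eq_bigr => m _; rewrite malgU_Z.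
Qed.

Lemma iota2_linext : iota2 = linext (fun m => << mon_map inr m >>).
Proof.
by apply: functional_extensionality => a; apply: eq_bigr => m _; rewrite malgU_Z.
Qed.

Lemma Delta_linear c a b : Delta (c *: a + b) = c *: Delta a + Delta b.
Proof. by rewrite Delta_linext; exact: linextP. Qed.

Lemma DeltaE m : Delta << m >> = DeltaU CC m.
Proof. by rewrite Delta_linext linextU1. Qed.

Lemma iota1U m : iota1 << m >> = << mon_map inl m >>.
Proof. by rewrite iota1_linext linextU1. Qed.

Lemma iota2U m : iota2 << m >> = << mon_map inr m >>.
Proof. by rewrite iota2_linext linextU1. Qed.

Lemma tensU k l : tens << k >> << l >> = << emb k l >>.
Proof. by rewrite /tens iota1U iota2U malgUM. Qed.

Lemma tens_linearl c a a' b : tens (c *: a + a') b = c *: tens a b + tens a' b.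
Proof.
by rewrite /tens iota1_linext linextP mulrDl -scalerAl.
Qed.

Lemma tens_linearr c a b b' : tens a (c *: b + b') = c *: tens a b + tens a b'.
Proof.
by rewrite /tens iota2_linext linextP mulrDr -scalerAr.
Qed.

(** * Restriction of scalars from [A] to [CC] *)

Section RestrictionOfScalars.
Variables (A : comAlgType CC) (M : lmodType A).

(* [M] with scalars restricted along [CC -> A]. *)
Definition restr : Type := M.
HB.instance Definition _ := GRing.Zmodule.on restr.

Definition restr_scale (c : CC) (x : restr) : restr := c%:A *: (x : M).

Lemma restr_scaleA c d x :
  restr_scale c (restr_scale d x) = restr_scale (c * d) x.
Proof. by rewrite /restr_scale scalerA -scalerAl mul1r scalerA. Qed.
Lemma restr_scale1 : left_id 1 restr_scale.
Proof. by move=> x; rewrite /restr_scale !scale1r. Qed.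
Lemma restr_scaleDr : right_distributive restr_scale +%R.
Proof. by move=> c x y; rewrite /restr_scale scalerDr. Qed.
Lemma restr_scaleDl x : {morph restr_scale^~ x : c d / c + d}.
Proof. by move=> c d; rewrite /restr_scale !scalerDl. Qed.

HB.instance Definition _ := GRing.Zmodule_isLmodule.Build CC restr
  restr_scaleA restr_scale1 restr_scaleDr restr_scaleDl.

(** The coefficients lie in [CC] and the summands in an [A]-module; over [CC] the left side is a
    linear extension, to which [linext_DeltaU] applies. *)
Lemma sum_Delta (g : mon -> mon -> M) m :
  \sum_(k <- msupp (Delta << m >>))
     ((Delta << m >>)@_k)%:A *: g (mleft k) (mright k) = sw m g.
Proof.
rewrite DeltaE.
rewrite -[LHS]/(linext (fun k => g (mleft k) (mright k) : restr) (DeltaU CC m)).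
rewrite linext_DeltaU; apply: eq_sw => k l.
by rewrite mleft_emb mright_emb.
Qed.

End RestrictionOfScalars.

(** Both sides are bilinear in [a] and [b], so monomials suffice. Serves both multiplicative laws of
    a bicharacter, with [m] the argument that gets split. *)
Lemma sw_mul_ext (R : comNzRingType) (A : comAlgType R) (K : conomType) m
    (f : {malg R[K]} -> A) (h : mon -> {malg R[K]} -> A)
    (fP : forall c a b, f (c *: a + b) = c *: f a + f b)
    (hP : forall k c a b, h k (c *: a + b) = c *: h k a + h k b) :
  (forall k l, f (<< k >> * << l >>) =
               sw m (fun x y => h x << k >> * h y << l >>)) ->
  forall a b, f (a * b) = sw m (fun x y => h x a * h y b).
Proof.
move=> fM a b.
have f0 := linear_map0 fP.
have h0 k := linear_map0 (hP k).
elim/malg_ind: a => [|c k p IH].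
  by rewrite mul0r f0 /sw /ssum big1 // => ? _; rewrite h0 mul0r.
rewrite mulrDl -scalerAl fP IH.
under [RHS]eq_sw => x y do rewrite hP mulrDl -scalerAl.
rewrite swD -(raddf_sw ( *:%R c)); congr (_ *: _ + _) => {IH p c}.
elim/malg_ind: b => [|c l p IH].
  by rewrite mulr0 f0 /sw /ssum big1 // => ? _; rewrite h0 mulr0.
rewrite mulrDr -scalerAr fP IH.
under [RHS]eq_sw => x y do rewrite hP mulrDr -scalerAr.
by rewrite swD -(raddf_sw ( *:%R c)) fM.
Qed.

(** * Bicharacters and their matrices on monomials *)

Section Bicharacters.
Variable A : comAlgType CC.
Implicit Types (r : {linear V0V0 -> A}).

Definition bimat r (k l : mon) : A := r << emb k l >>.

Lemma rtU r k l : rt r << k >> << l >> = bimat r k l.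
Proof. by rewrite /rt tensU. Qed.

Lemma rt_linearl r c a a' b : rt r (c *: a + a') b = c *: rt r a b + rt r a' b.
Proof. by rewrite /rt tens_linearl linearP. Qed.

Lemma rt_linearr r c a b b' : rt r a (c *: b + b') = c *: rt r a b + rt r a b'.
Proof. by rewrite /rt tens_linearr linearP. Qed.

Lemma rt0l r a : rt r 0 a = 0.
Proof. exact: (linear_map0 (fun c x y => rt_linearl r c x y a)). Qed.

Lemma rt0r r a : rt r a 0 = 0.
Proof. exact: (linear_map0 (fun c x y => rt_linearr r c a x y)). Qed.

Lemma linear_linext r (t : V0V0) :
  r t = linext (fun k => bimat r (mleft k) (mright k)) t.
Proof.
elim/malg_ind: t => [|c k p IH]; first by rewrite !linear0.
by rewrite !linearP /= linextU1 -IH /bimat emb_split.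
Qed.

Lemma linear_DeltaU r m : r (Delta << m >>) = diag (bimat r) m.
Proof.
rewrite linear_linext DeltaE linext_DeltaU; apply: eq_sw => k l.
by rewrite mleft_emb mright_emb.
Qed.

Lemma sw2_linext t (F : V0 -> V0 -> A) :
  sw2 t F = linext (fun k => F << mleft k >> << mright k >>) t.
Proof. by []. Qed.

Lemma sw2_DeltaU m (F : V0 -> V0 -> A) :
  sw2 (Delta << m >>) F = sw m (fun k l => F << k >> << l >>).
Proof.
rewrite sw2_linext DeltaE linext_DeltaU; apply: eq_sw => k l.
by rewrite mleft_emb mright_emb.
Qed.

Lemma counitA m : (Defs.eta << m >>)%:A = counit A m.
Proof.
rewrite eta_linext linextU1 /counit.
by case: eqP; rewrite ?scale1r ?scale0r.
Qed.

Lemma bichar_bimat r : bicharacter r -> bichar (bimat r).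
Proof.
case=> r1 r1' rl rr; split=> [m|m|a b c|a b c].
- by rewrite -rtU r1 counitA.
- by rewrite -rtU r1' counitA.
- rewrite -rtU -malgUM rl sw2_DeltaU; apply: eq_sw => k l; congr (_ * _); exact: rtU.
rewrite -rtU -malgUM rr sw2_DeltaU.
by apply: eq_sw => k l; congr (_ * _); exact: rtU.
Qed.

Lemma symm_bimat r : symmetric_bichar r -> symm (bimat r).
Proof. by move=> rs k l; rewrite -[LHS]rtU rs; exact: rtU. Qed.

(** Every law is linear in each of its variables. The argument under the coproduct is reduced to a
    monomial first, then [sw_mul_ext] treats the other two. *)
Lemma bichar_bicharacter r : bichar (bimat r) -> bicharacter r.
Proof.
have eta0 : Defs.eta 0 = 0 by rewrite eta_linext linear0.
have etaP c k p : (Defs.eta (c *: << k >> + p))%:A =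
    c *: (Defs.eta << k >>)%:A + (Defs.eta p)%:A :> A.
  by rewrite eta_linext linearP scalerDl scalerA.
have sw20 F : sw2 (Delta 0) F = 0 :> A.
  by rewrite sw2_linext Delta_linext !linear0.
have sw2P c k p F :
    sw2 (Delta (c *: << k >> + p)) F =
    c *: sw2 (Delta << k >>) F + sw2 (Delta p) F :> A.
  by rewrite Delta_linear; exact: linextP.
case=> r1 r1' rl rr; split.
- elim/malg_ind => [|c k p IH]; first by rewrite rt0r eta0 scale0r.
  by rewrite rt_linearr etaP IH counitA -r1 rtU.
- elim/malg_ind => [|c k p IH]; first by rewrite rt0l eta0 scale0r.
  by rewrite rt_linearl etaP IH counitA -r1' rtU.
- move=> a b; elim/malg_ind => [|d n q IH]; first by rewrite rt0r sw20.
  rewrite rt_linearr sw2P IH; congr (_ *: _ + _) => {IH q d}.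
  rewrite sw2_DeltaU.
  apply: (sw_mul_ext (fun c x y => rt_linearl r c x y << n >>)
                     (fun k c x y => rt_linearl r c x y << k >>)) => k l.
  transitivity (bimat r (k ** l) n); first by rewrite malgUM; exact: rtU.
  rewrite [LHS]rl.
  by apply: eq_sw => x y; congr (_ * _); symmetry; exact: rtU.
move=> a b c; elim/malg_ind: a => [|d n q IH]; first by rewrite rt0l sw20.
rewrite rt_linearl sw2P IH; congr (_ *: _ + _) => {IH q d}.
rewrite sw2_DeltaU.
apply: (sw_mul_ext (fun c x y => rt_linearr r c << n >> x y)
                   (fun k c x y => rt_linearr r c << k >> x y)) => k l.
transitivity (bimat r n (k ** l)); first by rewrite malgUM; exact: rtU.
rewrite [LHS]rr.
by apply: eq_sw => x y; congr (_ * _); symmetry; exact: rtU.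
Qed.

Definition linmat (f : mon -> mon -> A) : {linear V0V0 -> A} :=
  linext (fun k => f (mleft k) (mright k)).

Lemma bimatK f : bimat (linmat f) = f.
Proof.
do 2 apply: functional_extensionality => ?.
by rewrite /bimat /linmat /= linextU1 mleft_emb mright_emb.
Qed.

End Bicharacters.

Lemma linext_linear_fun (K : choiceType) (R : comNzRingType) (M : lmodType R)
    c (h h' : K -> M) (p : {malg R[K]}) :
  linext (fun k => c *: h k + h' k) p = c *: linext h p + linext h' p.
Proof.
rewrite /linext scaler_sumr -big_split; apply: eq_bigr => k _ /=.
by rewrite scalerDr !scalerA mulrC.
Qed.

(** * Twisted products and [EQ] as convolutions *)

Section Twisting.
Variable A : comNzRingType.
Local Notation B := {malg A[mon]}.
Implicit Types (s r : mon -> mon -> A) (p q : B) (f : mon -> A).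

(** Scalars become constant polynomials, so that bicharacters and the inclusion [monX] of monomials
    take values in one ring and can be convolved. *)
Definition cst2 s m n : B := (s m n)%:MP.
Definition cst1 f m : B := (f m)%:MP.
Definition monX m : B := << m >>.

Lemma malgC_sw m (g : mon -> mon -> A) :
  (sw m g)%:MP = sw m (fun k l => (g k l)%:MP) :> B.
Proof. exact: (raddf_sw (@malgC _ A)). Qed.

Lemma cst1_diag r : cst1 (diag r) = diag (cst2 r).
Proof. by apply: functional_extensionality => m; exact: malgC_sw. Qed.

Lemma cst2_conv s r : cst2 (conv2 s r) = conv2 (cst2 s) (cst2 r).
Proof.
do 2 apply: functional_extensionality => ?.
rewrite /cst2 /conv2 malgC_sw; apply: eq_sw => a b.
by rewrite malgC_sw; apply: eq_sw => k l; rewrite mpolyCM.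
Qed.

Lemma cst2_counit : cst2 (tens2 (counit A) (counit A)) = tens2 (counit B) (counit B).
Proof.
do 2 apply: functional_extensionality => ?.
by rewrite /cst2 /tens2 mpolyCM /counit !mpolyC_nat.
Qed.

Lemma bichar_cst2 r : bichar r -> bichar (cst2 r).
Proof.
case=> r1 r1' rl rr; split=> [m|m|a b k|a b k]; rewrite /cst2.
- by rewrite r1 /counit mpolyC_nat.
- by rewrite r1' /counit mpolyC_nat.
- rewrite rl malgC_sw; apply: eq_sw => ? ?; exact: mpolyCM.
- rewrite rr malgC_sw; apply: eq_sw => ? ?; exact: mpolyCM.
Qed.

(* [bul] and [EQ] for an arbitrary coefficient ring, in terms of the values of
   the bicharacter on monomials; see [bulE] and [EQE]. *)
Definition twmul s p q : B :=
  linext (fun m => linext (conv2 (mu monX) (cst2 s) m) q) p.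

Definition tweq f p : B := linext (conv1 (cst1 f) monX) p.

Lemma tweqU f m : tweq f << m >> = conv1 (cst1 f) monX m.
Proof. exact: linextU1. Qed.

Lemma twmulU s m n : twmul s << m >> << n >> = conv2 (mu monX) (cst2 s) m n.
Proof. by rewrite /twmul !linextU1. Qed.

Lemma tweqP f c p q : tweq f (c *: p + q) = c *: tweq f p + tweq f q.
Proof. exact: linextP. Qed.

Lemma twmul_linearl s c p p' q :
  twmul s (c *: p + p') q = c *: twmul s p q + twmul s p' q.
Proof. exact: linextP. Qed.

Lemma twmul_linearr s c p q q' :
  twmul s p (c *: q + q') = c *: twmul s p q + twmul s p q'.
Proof.
pose H q m := linext (conv2 (mu monX) (cst2 s) m) q.
transitivity (linext (fun m => c *: H q m + H q' m) p).
  apply: (congr1 (fun h => linext h p)); apply: functional_extensionality => m.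
  exact: linextP.
exact: (linext_linear_fun c (H q) (H q') p).
Qed.

Lemma linear_sw (V W : lmodType A) (h : V -> W) m (g : mon -> mon -> V) :
  (forall c x y, h (c *: x + y) = c *: h x + h y) ->
  h (sw m g) = sw m (fun k l => h (g k l)).
Proof.
move=> hP; have h0 := linear_map0 hP.
have hD x y : h (x + y) = h x + h y by rewrite -[x]scale1r hP !scale1r.
rewrite /sw /ssum; elim: (splits _) => [|z s IH]; first by rewrite !big_nil.
by rewrite !big_cons hD IH.
Qed.

Lemma linear_malgCl (h : B -> B) c x :
  (forall c x y, h (c *: x + y) = c *: h x + h y) ->
  h (c%:MP * x) = c%:MP * h x.
Proof.
move=> hP; have h0 := linear_map0 hP.
by rewrite !mul_malgC -[c *: x]addr0 hP h0 addr0.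
Qed.

Lemma linear_malgCr (h : B -> B) c x :
  (forall c x y, h (c *: x + y) = c *: h x + h y) ->
  h (x * c%:MP) = h x * c%:MP.
Proof.
move=> hP; apply: etrans (congr1 h (mulrC x c%:MP)) _.
apply: etrans (linear_malgCl _ _ hP) _; exact: mulrC.
Qed.

Lemma tweq_conv2 f s m n :
  tweq f (conv2 (mu monX) (cst2 s) m n) =
  conv2 (mu (conv1 (cst1 f) monX)) (cst2 s) m n.
Proof.
rewrite /conv2 (linear_sw _ _ (tweqP f)); apply: eq_sw => a b.
rewrite (linear_sw _ _ (tweqP f)); apply: eq_sw => k l.
apply: etrans (linear_malgCr _ _ (tweqP f)) _.
by congr (_ * _); exact: tweqU.
Qed.

(** Bilinearity pulls out the constants [f m'] and [f n'], leaving the twisted product of [m''] and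
    [n'']. *)
Lemma twmul_conv1 f s m n :
  twmul s (conv1 (cst1 f) monX m) (conv1 (cst1 f) monX n) =
  conv2 (tens2 (cst1 f) (cst1 f)) (conv2 (mu monX) (cst2 s)) m n.
Proof.
have Pl q c x y : twmul s (c *: x + y) q = c *: twmul s x q + twmul s y q.
  exact: twmul_linearl.
apply: etrans (linear_sw _ _ (Pl _)) _; apply: eq_sw => a b.
apply: etrans (linear_malgCl _ _ (Pl _)) _.
have Pr := fun c x y => twmul_linearr s c (monX b) x y.
apply: etrans (congr1 ( *%R _) (linear_sw _ _ Pr)) _.
rewrite mulr_sw; apply: eq_sw => k l.
rewrite -[RHS]mulrA; apply: (congr1 ( *%R _)).
apply: etrans (linear_malgCl _ _ Pr) _.
by congr (_ * _); exact: twmulU.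
Qed.

Lemma bilin_ext (F G : B -> B -> B) :
  (forall c x y q, F (c *: x + y) q = c *: F x q + F y q) ->
  (forall c p x y, F p (c *: x + y) = c *: F p x + F p y) ->
  (forall c x y q, G (c *: x + y) q = c *: G x q + G y q) ->
  (forall c p x y, G p (c *: x + y) = c *: G p x + G p y) ->
  (forall m n, F << m >> << n >> = G << m >> << n >>) ->
  forall p q, F p q = G p q.
Proof.
move=> Fl Fr Gl Gr FG p q.
elim/malg_ind: p => [|c m p IH].
  by rewrite (@linear_map0 _ _ _ (F^~ q)) ?(@linear_map0 _ _ _ (G^~ q)).
rewrite Fl Gl IH.
apply: (congr1 (fun z => c *: z + _)) => {IH c p}.
elim/malg_ind: q => [|c n q IH].
  by rewrite (@linear_map0 _ _ _ (F << m >>)) ?(@linear_map0 _ _ _ (G << m >>)).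
by rewrite Fr Gr IH; apply: (congr1 (fun z => c *: z + _)); exact: FG.
Qed.

(** On monomials both sides are convolutions, and they agree by [mu_conv_diag] over the polynomial
    ring. *)
Lemma tweq_twmul s1 s2 r : bichar r -> symm r ->
  conv2 s1 (conv2 r r) = s2 ->
  forall p q,
  tweq (diag r) (twmul s1 p q) = twmul s2 (tweq (diag r) p) (tweq (diag r) q).
Proof.
move=> br sr <-; set E := tweq (diag r); have EP := tweqP (diag r).
apply: bilin_ext => [c x y q|c p x y|c x y q|c p x y|m n].
- by rewrite twmul_linearl [LHS]EP.
- by rewrite twmul_linearr [LHS]EP.
- apply: etrans (congr1 (fun z => twmul _ z _) (EP c x y)) _.
  exact: twmul_linearl.
- apply: etrans (congr1 (twmul _ _) (EP c x y)) _.
  exact: twmul_linearr.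
transitivity (conv2 (mu (conv1 (cst1 (diag r)) monX)) (cst2 s1) m n).
  by apply: etrans (congr1 _ (twmulU _ _ _)) _; exact: tweq_conv2.
apply: etrans (congr2 (twmul _) (esym (tweqU _ _)) (esym (tweqU _ _))).
apply: etrans (esym (twmul_conv1 _ _ _ _)).
have sR : symm (cst2 r) by move=> k l; apply: (congr1 malgC); exact: sr.
apply: (congr1 (fun h : mon -> mon -> B => h m n)); rewrite cst1_diag.
apply: etrans (mu_conv_diag _ _ (bichar_cst2 br) sR) _.
apply: (congr1 (conv2 _)); apply: (congr1 (conv2 _)); symmetry.
by apply: etrans (cst2_conv _ _) _; apply: (congr1 (conv2 _)); exact: cst2_conv.
Qed.

(** Composition of the two maps is convolution with [diag (conv2 r r')], here the counit. *)
Lemma tweq_tweq r r' p : conv2 r r' = tens2 (counit A) (counit A) ->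
  tweq (diag r') (tweq (diag r) p) = p.
Proof.
move=> rr'; elim/malg_ind: p => [|c m p IH].
  rewrite (linear_map0 (tweqP (diag r))); exact: linear_map0 (tweqP _).
apply: etrans (congr1 (tweq _) (tweqP _ _ _ _)) _.
apply: etrans (tweqP _ _ _ _) _.
apply: (congr2 +%R _ IH); apply: (congr1 ( *:%R c)) => {IH c p}.
apply: etrans (congr1 (tweq _) (tweqU _ _)) _.
transitivity (conv1 (cst1 (diag r)) (conv1 (cst1 (diag r')) monX) m).
  apply: etrans (linear_sw _ _ (tweqP _)) _; apply: eq_sw => k l.
  apply: etrans (linear_malgCl _ _ (tweqP _)) _.
  by apply: (congr1 ( *%R _)); exact: tweqU.
by rewrite conv1A !cst1_diag conv1_diag -cst2_conv rr' cst2_counit diag_counit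
  conv1_counit.
Qed.

Lemma tweq1 r : bichar r -> tweq (diag r) 1 = 1.
Proof.
case=> r1 _ _ _; apply: etrans (tweqU _ _) _.
by rewrite /conv1 sw1 /cst1 /diag sw1 r1 /counit eqxx mul1r.
Qed.

Lemma twmul_counit p q : twmul (tens2 (counit A) (counit A)) p q = p * q.
Proof.
move: p q; apply: bilin_ext => [c x y q|c p x y|c x y q|c p x y|m n].
- exact: twmul_linearl.
- exact: twmul_linearr.
- by rewrite mulrDl -scalerAl.
- by rewrite mulrDr -scalerAr.
rewrite twmulU cst2_counit conv2C conv2_counit /mu.
by rewrite malgUM.
Qed.

End Twisting.

(** * Comparison with the defining sums *)

Section Comparison.
Variable A : comAlgType CC.
Implicit Types (r t : {linear V0V0 -> A}).

Lemma EQE r : EQ r = tweq (diag (bimat r)).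
Proof.
apply: (congr1 (fun h => linext h)); apply: functional_extensionality => m.
pose g k l : V0A A := diag (bimat r) k *: << l >>.
transitivity (\sum_(k <- msupp (Delta << m >>))
     ((Delta << m >>)@_k)%:A *: g (mleft k) (mright k)).
  by apply: eq_bigr => k _; rewrite -scalerA linear_DeltaU.
apply: etrans (sum_Delta g m) _.
by apply: eq_sw => k l; symmetry; exact: mul_malgC.
Qed.

Lemma bulE t p q : bul t p q = twmul (bimat t) p q.
Proof.
apply: eq_bigr => m _; rewrite [X in _ = _ *: X]/linext scaler_sumr.
apply: eq_bigr => n _; rewrite -scalerA; apply: (congr1 ( *:%R _)).
apply: (congr1 ( *:%R _)).
pose h a b k l : V0A A := bimat t b l *: << a ** k >>.
(* Distributing the two coefficients over nested sums lets [sum_Delta] act on each. *)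
transitivity (\sum_(k <- msupp (Delta << m >>)) ((Delta << m >>)@_k)%:A *:
    \sum_(l <- msupp (Delta << n >>)) ((Delta << n >>)@_l)%:A *:
      h (mleft k) (mright k) (mleft l) (mright l)).
  apply: eq_bigr => k _; rewrite scaler_sumr; apply: eq_bigr => l _.
  rewrite /h !scalerA malgUM; apply: (congr1 ( *:%R^~ _)).
  apply: (congr2 *%R); last exact: rtU.
  by rewrite -scalerAl mul1r scalerA.
transitivity (sw m (fun a b => sw n (h a b))).
  rewrite -sum_Delta; apply: eq_bigr => k _; apply: (congr1 ( *:%R _)).
  exact: sum_Delta.
do 2 (apply: eq_sw => ? ?).
by rewrite [RHS]mulrC; symmetry; exact: mul_malgC.
Qed.

Lemma EQ_alg_iso r s1 s2 : bichar (bimat r) -> symm (bimat r) ->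
  conv2 (bimat s1) (conv2 (bimat r) (bimat r)) = bimat s2 ->
  alg_iso (EQ r) (bul s1) (bul s2).
Proof.
move=> br sr rs; rewrite EQE; split.
- exact: tweqP.
- exists (tweq (diag (scl (-1) (bimat r)))) => p; apply: tweq_tweq.
    by rewrite conv2C scl_inv.
  by rewrite scl_inv.
- exact: tweq1.
by move=> p q; rewrite !bulE; exact: tweq_twmul.
Qed.

End Comparison.

(** * Existence of the intertwiner *)

Lemma half_exists (F : numFieldType) (A : comAlgType F) :
  exists c : A, c + c = 1.
Proof.
exists (2^-1)%:A; rewrite -scalerDl -mulr2n -(mulr_natr 2^-1 2) mulVf ?scale1r //.
by rewrite Num.Theory.pnatr_eq0.
Qed.

(** The hypotheses concern matrices, so that the unit of convolution can be used directly as
    [s1]. *)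
Lemma EQ_intertwines (A : comAlgType CC) (s1 s2 : {linear V0V0 -> A}) :
  bichar (bimat s1) -> symm (bimat s1) ->
  bichar (bimat s2) -> symm (bimat s2) ->
  exists r : {linear V0V0 -> A},
    bicharacter r /\ alg_iso (EQ r) (bul s1) (bul s2).
Proof.
move=> b1 t1 b2 t2; have [c c2] := half_exists A.
have [h [bh sh h2]] := bichar_sqrt c2 b1 t1 b2 t2.
exists (linmat h); split; first by apply: bichar_bicharacter; rewrite bimatK.
by apply: EQ_alg_iso; rewrite bimatK.
Qed.

Theorem theorem3p1 (A : comAlgType CC) :
  (forall s1 s2 : {linear V0V0 -> A},
     bicharacter s1 -> symmetric_bichar s1 ->
     bicharacter s2 -> symmetric_bichar s2 ->
     exists r : {linear V0V0 -> A},
       bicharacter r /\ alg_iso (EQ r) (bul s1) (bul s2)) /\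
  (forall s : {linear V0V0 -> A},
     bicharacter s -> symmetric_bichar s ->
     exists r : {linear V0V0 -> A},
       bicharacter r /\ alg_iso (EQ r) *%R (bul s)).
Proof.
split=> [s1 s2 b1 t1 b2 t2|s bs ss].
  by apply: EQ_intertwines; do ?[exact: bichar_bimat | exact: symm_bimat].
pose e := linmat (tens2 (counit A) (counit A)).
have be : bichar (bimat e).
  (* The unit is the zeroth power of [s], hence a bicharacter. *)
  by rewrite bimatK -(scl0 (bichar_bimat bs)); exact/bichar_scl/bichar_bimat.
have se : symm (bimat e).
  by rewrite bimatK => m n; exact: mulrC.
have [r [br [rP rbij r1 rM]]] := EQ_intertwines be se
  (bichar_bimat bs) (symm_bimat ss).
exists r; split; [exact: br | split; [exact: rP | exact: rbij | exact: r1 |]] => p q.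
apply: etrans (rM p q); apply: (congr1 (EQ r)); symmetry.
apply: etrans (bulE _ _ _) _; rewrite bimatK; exact: twmul_counit.
Qed.
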